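(* Let $\sigma\in\mathcal{W}_{2,ac}(\mathbb{R}^n)$ and $\mu\in\mathcal{W}_2(\mathbb{R}^n)$. Then for any $P\in O(n)$, $$W_2\big((T_{\sigma,\mu;P})_\sharp\sigma,\mu\big)\le2\inf_{S\in\mathcal{S}}W_2(S_\sharp\sigma,\mu),$$ where $\mathcal{S}=\{S:\mathbb{R}^n\to\mathbb{R}^n,\ S(x)=ax+b\mid a>0,\ b\in\mathbb{R}^n\}$.
   Context: $\mathcal{W}_2(\mathbb{R}^n)$ is the set of Borel probability measures on $\mathbb{R}^n$ with finite second moment, and $\mathcal{W}_{2,ac}(\mathbb{R}^n)$ the subset of those absolutely continuous with respect to Lebesgue measure. $\sharp$ denotes pushforward. $W_2(\alpha,\beta)=\inf_\pi(\int\|x-y\|^2d\pi(x,y))^{1/2}$ over couplings $\pi$ of $\alpha,\beta$. For $\theta\in S^{n-1}$, $\sigma^\theta$ is the pushforward of $\sigma$ under $x\mapsto x\cdot\theta$. For one-dimensional measures $\alpha$ (absolutely continuous) and $\beta$, $T_\alpha^\beta=F_\beta^{-1}\circ F_\alpha$ is the optimal transport map ($F_\alpha$ the cumulative distribution function, $F_\beta^{-1}$ the quantile function), i.e. the $\alpha$-a.e. unique nondecreasing map pushing $\alpha$ to $\beta$. For $P=[\theta_1,\ldots,\theta_n]\in O(n)$ (orthogonal matrix with columns $\theta_i$), $T_{\sigma,\mu;P}(x)=\sum_{i=1}^nT_{\sigma^{\theta_i}}^{\mu^{\theta_i}}(x\cdot\theta_i)\,\theta_i$. *)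

(* Defs.v *)
From HB Require Import structures.
From mathcomp Require Import all_boot all_order all_algebra.
From mathcomp Require Import all_classical all_reals all_analysis measurable_realfun.

Set Implicit Arguments.
Unset Strict Implicit.
Unset Printing Implicit Defensive.

Import Order.TTheory GRing.Theory Num.Theory.
Import numFieldNormedType.Exports.

Local Open Scope classical_set_scope.
Local Open Scope ring_scope.

(* R^n as column vectors, with the Borel sigma-algebra of its usual topology. *)
Definition eucl (R : realType) (n : nat) : Type := 'cV[R]_n.

HB.instance Definition _ (R : realType) (n : nat) :=
  GRing.Lmodule.on (eucl R n).
HB.instance Definition _ (R : realType) (n : nat) :=
  Measurable.copy (eucl R n) (g_sigma_algebraType (@open 'cV[R]_n)).

Definition dot (R : realType) (n : nat) (x y : 'cV[R]_n) : R :=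
  \sum_(i < n) x i 0 * y i 0.

(* The library's norm on matrices is the sup norm, hence this definition. *)
Definition enorm (R : realType) (n : nat) (x : 'cV[R]_n) : R :=
  Num.sqrt (dot x x).

(* Lebesgue measure on R^n, built as an iterated product measure: R^0 carries
   the unit mass, and R^(n+1) is identified with R * R^n. *)
Fixpoint lebesgue_eucl (R : realType) (n : nat) : set (eucl R n) -> \bar R :=
  match n with
  | 0 => \d_(0 : eucl R 0)
  | m.+1 => pushforward (lebesgue_measure \x @lebesgue_eucl R m)%E
              (fun p : R * eucl R m => col_mx p.1%:M p.2 : eucl R m.+1)
  end.

Definition second_moment_finite (R : realType) (n : nat)
    (mu : probability (eucl R n) R) : Prop :=
  (\int[mu]_x (enorm x ^+ 2)%:E < +oo)%E.

Definition wass2_space (R : realType) (n : nat) :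
    set (probability (eucl R n) R) :=
  [set mu | second_moment_finite mu].

Definition wass2_ac_space (R : realType) (n : nat) :
    set (probability (eucl R n) R) :=
  [set mu | wass2_space mu /\ mu `<< @lebesgue_eucl R n].

(* alpha and beta are plain set functions, so that the library's pushforward
   can be plugged in without first proving that the map is measurable. *)
Definition coupling (R : realType) (n : nat)
    (alpha beta : set (eucl R n) -> \bar R) :
    set (probability (eucl R n * eucl R n)%type R) :=
  [set pi | forall A, measurable A ->
     pushforward pi fst A = alpha A /\ pushforward pi snd A = beta A].

Definition W2 (R : realType) (n : nat)
    (alpha beta : set (eucl R n) -> \bar R) : \bar R :=
  ereal_inf [set ((\int[pi]_z (enorm (z.1 - z.2) ^+ 2)%:E) `^ (2^-1))%E
            | pi in coupling alpha beta].

Definition proj (R : realType) (n : nat) (theta : 'cV[R]_n) : eucl R n -> R :=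
  fun x => dot x theta.

Lemma measurable_proj (R : realType) (n : nat) (theta : 'cV[R]_n) :
  measurable_fun setT (proj theta).
Proof.
have cproj : continuous (proj theta : 'cV[R]_n -> R).
  apply: continuous_big => [|i _]; first exact: add_continuous.
  move=> x; apply: continuousM; first exact: coord_continuous.
  exact: cst_continuous.
apply: (measurability _ (RGenOpens.measurableE R)).
move=> _ [_ [a [b ->] <-]]; rewrite setTI; apply: sub_sigma_algebra.
by apply: open_comp => // x _; exact: cproj.
Qed.

HB.instance Definition _ (R : realType) (n : nat) (theta : 'cV[R]_n) :=
  @isMeasurableFun.Build _ _ _ _ (proj theta) (measurable_proj theta).

Definition slice (R : realType) (n : nat) (sigma : probability (eucl R n) R)
    (theta : 'cV[R]_n) : probability R R :=
  distribution sigma (proj theta).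

HB.instance Definition _ (R : realType) :=
  @isMeasurableFun.Build _ _ R R idfun (@measurable_id _ _ setT).

Definition cdf1 (R : realType) (alpha : probability R R) (x : R) : R :=
  fine (cdf (idfun : {RV alpha >-> R}) x).

(* Real-valued: [inf] returns 0 when the set is empty or unbounded below. This
   can happen only for p <= 0 or p >= 1. *)
Definition quantile (R : realType) (beta : probability R R) (p : R) : R :=
  inf [set x : R | p <= cdf1 beta x].

(* For atomless alpha, cdf1 alpha takes its values in ]0, 1[ alpha-almost
   everywhere, so the conventions above do not matter. *)
Definition transport1 (R : realType) (alpha beta : probability R R) : R -> R :=
  quantile beta \o cdf1 alpha.

Definition orthogonal_group (R : realType) (n : nat) : set 'M[R]_n :=
  [set P | P^T *m P = 1%:M].

Definition slice_map (R : realType) (n : nat)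
    (sigma mu : probability (eucl R n) R) (P : 'M[R]_n) (x : eucl R n) :
    eucl R n :=
  \sum_(i < n)
    transport1 (slice sigma (col i P)) (slice mu (col i P)) (dot x (col i P))
    *: col i P.

Definition scaling_translation (R : realType) (n : nat) :
    set (eucl R n -> eucl R n) :=
  [set S | exists a : R, exists b : eucl R n,
     0 < a /\ forall x, S x = a *: x + b].

(* Main.v *)
Require Import Defs.
From HB Require Import structures.
From mathcomp Require Import all_boot all_order all_algebra.
From mathcomp Require Import all_classical all_reals all_analysis.
From mathcomp Require Import ring lra measurable_realfun.

(* Let [S x = a x + b] and let [pi] couple [S_# sigma] with [mu]. Since [S] is
   invertible, pushing [pi] forward by (x, y) |-> (T (S^-1 x), y), where [T] is
   the slice map, couples [T_# sigma] with [mu]; no gluing is needed. As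
   |u + v|^2 <= 2 |u|^2 + 2 |v|^2, its cost is at most 4 times that of [pi] once
   E |T (S^-1 x) - x|^2 <= E |x - y|^2. By Parseval in the basis of columns of
   [P] this reduces to one-dimensional marginals, where T_i and S_i are both
   nondecreasing functions of the same variable, so that the left-hand side is
   an optimal cost.

   Optimality in dimension one follows from writing (x - y)^2 as the area of the
   square with side the interval between x and y: by Tonelli, the cost depends
   monotonically on the probabilities P(X <= s, t < Y) and P(Y <= s, t < X),
   which are bounded below by (F s - G t)^+ and (G s - F t)^+, with equality for
   the monotone coupling. *)

Set Implicit Arguments.
Unset Strict Implicit.
Unset Printing Implicit Defensive.

Import Order.TTheory GRing.Theory Num.Theory.
Import numFieldNormedType.Exports.

Local Open Scope classical_set_scope.
Local Open Scope ring_scope.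

Lemma measurable_pred d (T : measurableType d) (f : T -> bool) :
  measurable_fun setT f -> measurable [set x | f x].
Proof. by move=> mf; rewrite -[X in measurable X]setTI; exact: mf. Qed.

(** * Squared differences as planar areas *)

Section quadratic_cost.
Context {R : realType}.
Local Notation RT := (measurableTypeR R).
Definition lebesgue2 : set (RT * RT)%type -> \bar R :=
  (@lebesgue_measure R \x @lebesgue_measure R)%E.

HB.instance Definition _ := Measure.copy lebesgue2
  (@lebesgue_measure R \x @lebesgue_measure R)%E.

(** The squares over a nondecreasing exhaustion of the line exhaust the plane: monotonicity puts
    both coordinates of a point in a common [F n]. *)
Lemma lebesgue2_sigma_finite : sigma_finite setT lebesgue2.
Proof.
have /sigma_finiteP[F [TF ndF Foo]] := sigma_finiteT (@lebesgue_measure R).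
exists (fun n => F n `*` F n) => [|n].
  rewrite -setXTT TF; apply/predeqP => -[x y]; split.
    move=> [/= [n _ Fnx] [k _ Fky]]; exists (maxn n k) => //; split.
    - by move: x Fnx; exact/subsetPset/ndF/leq_maxl.
    - by move: y Fky; exact/subsetPset/ndF/leq_maxr.
  by move=> [n _ []/= ? ?]; split; exists n.
have [mFn Fnoo] := Foo n; split; first exact: measurableX.
by rewrite /lebesgue2 product_measure1E// lte_mul_pinfty// ge0_fin_numE.
Qed.

(* The library's sigma-finite structure on [m1 \x m2] is inferred only for
   subprobabilities. *)
HB.instance Definition _ := Measure_isSigmaFinite.Build _ _ _ lebesgue2
  lebesgue2_sigma_finite.

Lemma lebesgue2_square (x y : R) :
  lebesgue2 (`[x, y[ `*` `[x, y[) = (Num.max (y - x) 0 ^+ 2)%:E.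
Proof.
rewrite /lebesgue2 product_measure1E//= lebesgue_measure_itv/= lte_fin.
case: ltP => xy.
  by rewrite -EFinB -EFinM -expr2 max_l// subr_ge0 ltW.
by rewrite mule0 max_r ?subr_le0// expr0n.
Qed.

(** At most one of the two squares is nonempty, and its side is the distance between [x] and [y]. *)
Lemma sqr_diff_lebesgue2 (x y : R) :
  (((x - y) ^+ 2)%:E =
   lebesgue2 (`[x, y[ `*` `[x, y[) + lebesgue2 (`[y, x[ `*` `[y, x[))%E.
Proof.
rewrite !lebesgue2_square -EFinD; congr EFin.
have [xy|yx] := leP x y.
  by rewrite max_l ?subr_ge0// max_r ?subr_le0//; ring.
by rewrite max_r ?subr_le0 ?ltW// max_l ?subr_ge0 ?ltW//; ring.
Qed.

Context d (T : measurableType d) (P : probability T R).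
Implicit Types X Y Z : T -> R.

(** The region for Tonelli: its sections over sample points are the squares of [sqr_diff_lebesgue2],
    and its sections over points of the plane are events. *)
Definition straddle X Y : set (T * (RT * RT)) :=
  [set p | [&& X p.1 <= p.2.1, p.2.1 < Y p.1, X p.1 <= p.2.2 & p.2.2 < Y p.1]].

Lemma measurable_straddle X Y :
  measurable_fun setT X -> measurable_fun setT Y -> measurable (straddle X Y).
Proof.
move=> mX mY.
  have mX1 := measurableT_comp mX (@measurable_fst _ _ T (RT * RT)%type).
have mY1 := measurableT_comp mY (@measurable_fst _ _ T (RT * RT)%type).
have m1 : measurable_fun setT (fun p : T * (RT * RT) => p.2.1).
  exact: measurableT_comp (@measurable_fst _ _ RT RT) measurable_snd.
have m2 : measurable_fun setT (fun p : T * (RT * RT) => p.2.2).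
  exact: measurableT_comp (@measurable_snd _ _ RT RT) measurable_snd.
apply: measurable_pred; apply: measurable_and.
  exact: measurable_fun_ler.
apply: measurable_and; first exact: measurable_fun_ltr.
apply: measurable_and; first exact: measurable_fun_ler.
exact: measurable_fun_ltr.
Qed.

Lemma xsection_straddle X Y w :
  xsection (straddle X Y) w = `[X w, Y w[ `*` `[X w, Y w[.
Proof.
apply/seteqP; split=> -[s t]; rewrite /xsection/= inE/= !in_itv/=.
  by case/and4P => -> -> -> ->; split.
by case=> /andP[h1 h2] /andP[h3 h4]; apply/and4P; split.
Qed.

Lemma ysection_straddle X Y z :
  ysection (straddle X Y) z =
  [set w | X w <= Num.min z.1 z.2 /\ Num.max z.1 z.2 < Y w].
Proof.
apply/seteqP; split=> w; rewrite /ysection/= inE/= le_min gt_max.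
  by case/and4P => -> -> -> ->; split.
by case=> /andP[h1 h2] /andP[h3 h4]; apply/and4P; split.
Qed.

Lemma integral_sqr_diff X Y :
  measurable_fun setT X -> measurable_fun setT Y ->
  (\int[P]_w ((X w - Y w) ^+ 2)%:E =
   \int[lebesgue2]_z P (ysection (straddle X Y) z) +
   \int[lebesgue2]_z P (ysection (straddle Y X) z))%E.
Proof.
move=> mX mY.
have slab (U V : T -> R) : measurable_fun setT U -> measurable_fun setT V ->
    (\int[P]_w lebesgue2 (`[U w, V w[ `*` `[U w, V w[) =
     \int[lebesgue2]_z P (ysection (straddle U V) z))%E.
  (* The two integrals compute the product measure of one region by slicing it in either order. *)
  move=> mU mV; transitivity ((P \x lebesgue2)%E (straddle U V)).
    by apply: eq_integral => w _ /=; rewrite xsection_straddle.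
  have := indic_fubini_tonelli P lebesgue2 (measurable_straddle mU mV).
  by rewrite indic_fubini_tonelli_FE ?indic_fubini_tonelli_GE//;
    exact: measurable_straddle.
under eq_integral do rewrite sqr_diff_lebesgue2.
rewrite ge0_integralD//.
- by rewrite !slab.
- apply: eq_measurable_fun
    (measurable_fun_xsection lebesgue2 (measurable_straddle mX mY)).
  by move=> w _ /=; rewrite xsection_straddle.
- apply: eq_measurable_fun
    (measurable_fun_xsection lebesgue2 (measurable_straddle mY mX)).
  by move=> w _ /=; rewrite xsection_straddle.
Qed.

(** The hypotheses concern [s <= t] because a section of [straddle] depends on a point of the plane
    through the minimum and maximum of its coordinates. *)
Lemma le_integral_sqr_diff X Y Z :
  measurable_fun setT X -> measurable_fun setT Y -> measurable_fun setT Z ->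
  (forall s t, s <= t ->
    (P [set w | X w <= s /\ t < Z w]%R <= P [set w | X w <= s /\ t < Y w]%R)%E) ->
  (forall s t, s <= t ->
    (P [set w | Z w <= s /\ t < X w]%R <= P [set w | Y w <= s /\ t < X w]%R)%E) ->
  (\int[P]_w ((X w - Z w) ^+ 2)%:E <= \int[P]_w ((X w - Y w) ^+ 2)%:E)%E.
Proof.
move=> mX mY mZ XZ ZX; rewrite !integral_sqr_diff//; apply: leeD.
  apply: ge0_le_integral => //.
  - exact: measurable_fun_ysection (measurable_straddle mX mZ).
  - exact: measurable_fun_ysection (measurable_straddle mX mY).
  - move=> z _; rewrite !ysection_straddle; apply: XZ.
    by rewrite ge_min !le_max !lexx.
apply: ge0_le_integral => //.
- exact: measurable_fun_ysection (measurable_straddle mZ mX).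
- exact: measurable_fun_ysection (measurable_straddle mY mX).
- move=> z _; rewrite !ysection_straddle; apply: ZX.
  by rewrite ge_min !le_max !lexx.
Qed.

End quadratic_cost.

(** * Distribution and quantile functions *)

Section cdf_quantile.
Context {R : realType} (alpha : probability R R).
Local Notation F := (cdf1 alpha).

Lemma cdf1E x : (F x)%:E = alpha [set y | y <= x].
Proof. by rewrite -set_itvNyc /cdf1 fineK ?fin_num_measure. Qed.

Lemma cdf1_ge0 x : 0 <= F x.
Proof. by rewrite fine_ge0. Qed.

Lemma cdf1_le1 x : F x <= 1.
Proof. by rewrite -lee_fin /cdf1 fineK ?fin_num_measure// cdf_le1. Qed.

Lemma cdf1_nondecreasing : {homo F : x y / x <= y}.
Proof.
by move=> x y xy; rewrite fine_le ?fin_num_measure//; exact: cdf_nondecreasing.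
Qed.

Lemma measurable_cdf1 : measurable_fun setT F.
Proof. by apply: nondecreasing_measurable => //; exact: cdf1_nondecreasing. Qed.

Lemma cdf1_gt p : p < 1 -> exists x, p < F x.
Proof.
move=> p1; have /fine_cvg := cvg_cdfy1 (idfun : {RV alpha >-> R}).
by move=> /(cvgr_gt 1) /(_ _ p1) /filter_ex.
Qed.

Lemma cdf1_lt p : 0 < p -> exists x, F x < p.
Proof.
move=> p0; have /fine_cvg := cvg_cdfNy0 (idfun : {RV alpha >-> R}).
by move=> /(cvgr_lt 0) /(_ _ p0) /filter_ex.
Qed.

(** Galois connection. The bounds on [p] make the infimum a genuine one; right-continuity of [F]
    turns [F t < p] into [F (t + e) < p], so that [t + e] bounds the quantile from below. *)
Lemma quantile_le (p t : R) : 0 < p < 1 -> (quantile alpha p <= t) = (p <= F t).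
Proof.
move=> /andP[p0 p1]; set A := [set x : R | p <= F x].
have A0 : A !=set0 by have [x /ltW px] := cdf1_gt p1; exists x.
have lA : has_lbound A.
  have [y yp] := cdf1_lt p0; exists y => x /= px.
  rewrite leNgt; apply/negP => xy.
  have := lt_le_trans yp (le_trans px (cdf1_nondecreasing (ltW xy))).
  by rewrite ltxx.
apply/idP/idP => [|pt]; last exact: ge_inf.
apply: contraTT; rewrite -!ltNge => tp.
have [e e0 ep] : exists2 e : R, 0 < e & F (t + e) < p.
  have tcvg := @cdf_right_continuous _ _ _ _ (idfun : {RV alpha >-> R}) t.
  have /fine_cvg Fcvg :
      cdf (idfun : {RV alpha >-> R}) x @[x --> t^'+] --> (F t)%:E.
    by rewrite /cdf1 fineK ?fin_num_measure.
  have /cvgr_lt /(_ _ tp) nlt := Fcvg.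
  have [x [Fx tx]] : exists x, F x < p /\ t < x.
    apply: (@filter_ex _ t^'+); near=> x; split; near: x; first exact: nlt.
    exact: nbhs_right_gt.
  by exists (x - t); rewrite ?subr_gt0// addrC subrK.
apply: lt_le_trans (_ : t + e <= _); first by rewrite ltrDl.
apply: lb_le_inf => // x /= px; rewrite leNgt; apply/negP => xt.
have := lt_le_trans ep (le_trans px (cdf1_nondecreasing (ltW xt))).
by rewrite ltxx.
Unshelve. all: by end_near. Qed.

(** The endpoints, where the infimum may take its default value, are split off as singletons; on the
    open interval the Galois connection makes superlevel sets intervals. *)
Lemma measurable_quantile :
  measurable_fun (`[0, 1]%classic : set R) (quantile alpha).
Proof.
have -> : `[0, 1]%classic = [set 0] `|` [set 1] `|` `]0, 1[%classic :> set R.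
  apply/seteqP; split=> p /=; rewrite !in_itv/=.
    move=> /andP[]; rewrite le_eqVlt => /orP[/eqP<- _|p0]; first by left; left.
    rewrite le_eqVlt => /orP[/eqP->|p1]; first by left; right.
    by right; rewrite p0.
  by case=> [[->|->]|/andP[/ltW -> /ltW ->]]; rewrite ?lexx ?ler01.
apply/measurable_funU => //; first exact: measurableU.
split; first by apply/measurable_funU => //; split; exact: measurable_fun_set1.
apply: (measurability _ (RGenOInfty.measurableE R)).
move=> _ [_ [t ->] <-].
rewrite (_ : _ `&` _ = `]0, 1[ `&` `]F t, +oo[).
  exact: measurableI.
apply/seteqP; split=> p /= [pI]; have := pI; rewrite !in_itv/= !andbT => p01 tp.
  by split=> //; rewrite ltNge -quantile_le// -ltNge.
by split=> //; rewrite ltNge quantile_le// -ltNge.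
Qed.

Hypothesis atomless : forall c, alpha [set c] = 0%E.

(** Below the quantile [q], [F] is at most [p], so continuity from below bounds the mass of [y < q]
    by [p]; the point [q] adds nothing. *)
Lemma cdf1_quantile (p : R) : 0 < p < 1 -> F (quantile alpha p) = p.
Proof.
move=> p01; apply/eqP; rewrite eq_le -quantile_le// lexx andbT.
set q := quantile alpha p.
have lt_q : (alpha [set y | y < q]%R <= p%:E)%E.
  pose A n := [set y : R | y <= q - n.+1%:R^-1].
  have mA n : measurable (A n) by rewrite /A -set_itvNyc.
  have UA : \bigcup_n A n = [set y | y < q].
    apply/seteqP; split=> y /=.
      move=> [n _ /= yn]; apply: le_lt_trans yn _.
      by rewrite ltrBlDr ltrDl invr_gt0.
    rewrite -subr_gt0 => yq; have [n _ nq] := near_infty_natSinv_lt (PosNum yq).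
    have /= := nq n (leqnn n) => nyq.
    by exists n => //; rewrite /A/= lerBrDr -lerBrDl ltW.
  have cvgA : (alpha \o A) n @[n --> \oo] --> alpha [set y | y < q].
    rewrite -UA; apply: nondecreasing_cvg_mu => //.
      exact: bigcup_measurable.
    move=> m n mn; apply/subsetPset => y /= /le_trans; apply.
    by rewrite lerB// lef_pV2 ?posrE// ler_nat.
  rewrite -(cvg_lim _ cvgA)//; apply: lime_le.
    by apply/cvg_ex; exists (alpha [set y | y < q]).
  near=> n; rewrite /= /A -cdf1E lee_fin leNgt; apply/negP => /ltW.
  by rewrite -quantile_le// -/q leNgt ltrBlDr ltrDl invr_gt0 ltr0n.
rewrite -lee_fin cdf1E (_ : [set y | y <= q] = [set y | y < q] `|` [set q]).
  have mq : measurable [set y : R | y < q] by rewrite -set_itvNyo.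
  apply: (le_trans (measureU2 _ _ _)) => //.
  have q0 : (alpha [set q] <= 0)%E by rewrite atomless.
  by rewrite -[leRHS]adde0 leeD.
apply/seteqP; split=> y /=; rewrite le_eqVlt.
  by case/orP => [/eqP|]; [right|left].
by case=> [->|->]; rewrite ?orbT ?eqxx.
Unshelve. all: by end_near. Qed.

End cdf_quantile.

(** * The monotone coupling in dimension one *)

Lemma measurable_transport1 (R : realType) (alpha beta : probability R R) :
  measurable_fun setT (transport1 alpha beta).
Proof.
apply: measurable_comp (measurable_quantile beta) (measurable_cdf1 alpha) => //.
by move=> _ [x _ <-]/=; rewrite in_itv/= cdf1_ge0 cdf1_le1.
Qed.

Section monotone_coupling.
Context {R : realType} d (T : measurableType d) (P : probability T R).
Variables (alpha beta : probability R R) (W Y : T -> R).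
Hypotheses (mW : measurable_fun setT W) (mY : measurable_fun setT Y).
Hypothesis lawW : forall A, measurable A -> P (W @^-1` A) = alpha A.
Hypothesis lawY : forall A, measurable A -> P (Y @^-1` A) = beta A.
Hypothesis atomless : forall c, alpha [set c] = 0%E.
Local Notation F := (cdf1 alpha).
Local Notation G := (cdf1 beta).
Let Z w := transport1 alpha beta (W w).
(** Real-valued, so that linear arithmetic applies to probabilities. *)
Let pr (A : set T) : R := fine (P A).

Let prE A : measurable A -> (pr A)%:E = P A.
Proof. by move=> mA; rewrite fineK ?fin_num_measure. Qed.

Let pr_le A B : measurable A -> measurable B -> A `<=` B -> pr A <= pr B.
Proof. by move=> mA mB AB; rewrite -lee_fin !prE// le_measure ?inE. Qed.

Let prU A B : measurable A -> measurable B -> pr (A `|` B) <= pr A + pr B.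
Proof.
move=> mA mB; rewrite -lee_fin EFinD !prE//; last exact: measurableU.
exact: measureU2.
Qed.

Let pr_le1 A : measurable A -> pr A <= 1.
Proof. by move=> mA; rewrite -lee_fin prE// probability_le1. Qed.

Let pr_ge0 A : 0 <= pr A.
Proof. by rewrite fine_ge0. Qed.

Let prW s : pr [set w | W w <= s] = F s.
Proof.
apply: EFin_inj; rewrite cdf1E -lawW ?prE//; last by rewrite -set_itvNyc.
by apply: measurable_pred; exact: measurable_fun_ler.
Qed.

Let prY s : pr [set w | Y w <= s] = G s.
Proof.
apply: EFin_inj; rewrite cdf1E -lawY ?prE//; last by rewrite -set_itvNyc.
by apply: measurable_pred; exact: measurable_fun_ler.
Qed.

Let mFW : measurable_fun setT (F \o W).
Proof. exact: measurableT_comp (measurable_cdf1 alpha) mW. Qed.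

Let mZ : measurable_fun setT Z.
Proof. exact: measurableT_comp (measurable_transport1 alpha beta) mW. Qed.

Let mle (f g : T -> R) : measurable_fun setT f -> measurable_fun setT g ->
  measurable [set w | f w <= g w].
Proof. by move=> mf mg; apply: measurable_pred; exact: measurable_fun_ler. Qed.

Let mlt (f g : T -> R) : measurable_fun setT f -> measurable_fun setT g ->
  measurable [set w | f w < g w].
Proof. by move=> mf mg; apply: measurable_pred; exact: measurable_fun_ltr. Qed.

Let pr_itvW x y : x <= y -> pr [set w | x < W w /\ W w <= y] <= F y - F x.
Proof.
move=> xy; have mI : measurable [set w | x < W w /\ W w <= y].
  by apply: measurableI; [exact: mlt|exact: mle].
rewrite lerBrDl -!prW -lee_fin EFinD !prE//; [|exact: mle..].
rewrite -measureU//; last 2 first.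
- exact: mle.
- by apply/seteqP; split=> w //= [Wx [/(le_lt_trans Wx)]]; rewrite ltxx.
apply: le_measure; rewrite ?inE//; [|exact: mle|].
  by apply: measurableU => //; exact: mle.
by move=> w /= [/le_trans -> //|[]].
Qed.

Let pr_tailW x : pr [set w | x < W w] <= 1 - F x.
Proof.
rewrite lerBrDl -prW -lee_fin EFinD !prE//; [|exact: mlt|exact: mle].
rewrite -measureU; [|exact: mle|exact: mlt|].
  by apply: probability_le1; apply: measurableU; [exact: mle|exact: mlt].
by apply/seteqP; split=> w //= [Wx /(le_lt_trans Wx)]; rewrite ltxx.
Qed.

Let ndF x y : x <= y -> F x <= F y.
Proof. exact: cdf1_nondecreasing. Qed.

(* The null set on which the conventions for [quantile] outside ]0, 1[ matter. *)
Let N := [set w | F (W w) <= 0] `|` [set w | 1 <= F (W w)].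

Let mN : measurable N.
Proof. by apply: measurableU; exact: mle. Qed.

(** [F] attains every level [v] of ]0, 1[ at a quantile. The set where [F (W w) <= 0] lies to the
    left of it, hence has mass at most [v]; the other set lies to the right, with mass at most
    [1 - v]. Taking [v] near 0, respectively near 1, contradicts a positive mass. *)
Let prN : pr N <= 0.
Proof.
have low : pr [set w | F (W w) <= 0] <= 0.
  rewrite leNgt; apply/negP; set p := pr _ => p0.
  pose v := Num.min (2^-1) (p / 2).
  have v01 : 0 < v < 1 by rewrite /v lt_min gt_min; lra.
  have : p <= v.
    rewrite -(cdf1_quantile atomless v01) -prW; apply: pr_le; [exact: mle..|].
    move=> w /= Fw; rewrite leNgt; apply/negP => /ltW /ndF.
    rewrite cdf1_quantile//; lra.
  by rewrite /v le_min; lra.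
have high : pr [set w | 1 <= F (W w)] <= 0.
  rewrite leNgt; apply/negP; set p := pr _ => p0.
  have p1 : p <= 1 by apply: pr_le1; exact: mle.
  pose v := 1 - p / 2.
  have v01 : 0 < v < 1 by rewrite /v; lra.
  have : p <= 1 - v.
    rewrite -(cdf1_quantile atomless v01); apply: le_trans (pr_tailW _).
    apply: pr_le; [exact: mle|exact: mlt|].
    move=> w /= Fw; rewrite ltNge; apply/negP => /ndF.
    rewrite cdf1_quantile//; lra.
  by rewrite /v; lra.
by apply: le_trans (prU _ _) _; [exact: mle..|lra].
Qed.

(* The left-hand side is at most (F s - G t)^+ by monotonicity, and the
   right-hand side is at least that much for any coupling. *)
Lemma transport1_coupling_ge s t :
  (P [set w | W w <= s /\ t < Z w]%R <= P [set w | W w <= s /\ t < Y w]%R)%E.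
Proof.
have mWZ : measurable [set w | W w <= s /\ t < Z w].
  by apply: measurableI; [exact: mle|exact: mlt].
have mWY : measurable [set w | W w <= s /\ t < Y w].
  by apply: measurableI; [exact: mle|exact: mlt].
have mA : measurable [set w | W w <= s /\ G t < F (W w)].
  by apply: measurableI; [exact: mle|exact: mlt].
rewrite -!prE// lee_fin.
(* Outside [N], [quantile_le] turns [t < Z w] into [G t < F (W w)]. *)
have leA : pr [set w | W w <= s /\ t < Z w] <=
    pr [set w | W w <= s /\ G t < F (W w)].
  rewrite -[leRHS]addr0; apply: le_trans (lerD (lexx _) prN).
  apply: le_trans (prU _ _) => //; apply: pr_le => //; first exact: measurableU.
  move=> w /= [Ws tZ]; have [F0|F0] := leP (F (W w)) 0; first by right; left.
  have [F1|F1] := leP 1 (F (W w)); first by right; right.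
  by left; split=> //; rewrite ltNge -quantile_le ?F0// -ltNge.
have sY : F s - G t <= pr [set w | W w <= s /\ t < Y w].
  rewrite lerBlDr -prW -prY; apply: le_trans (prU _ _) => //; last exact: mle.
  apply: pr_le; [exact: mle|by apply: measurableU => //; exact: mle|].
  by move=> w /= Ws; have [|] := leP (Y w) t; [right|left].
apply: le_trans leA _; have [Gs|sG] := ltP (G t) (F s); last first.
  rewrite (_ : [set w | _] = set0); first by rewrite {1}/pr measure0 pr_ge0.
  apply/seteqP; split=> w //= [/ndF Ws]; lra.
(* The level [G t = 0] has no usable quantile, but there the bound is just [F s]. Otherwise the
   event forces [W] into the interval from the [G t]-quantile to [s]. *)
apply: le_trans _ sY; have [G0|G0] := leP (G t) 0.
  have -> : F s - G t = F s by have := cdf1_ge0 beta t; lra.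
  by rewrite -prW; apply: pr_le => //; [exact: mle|move=> w []].
have G01 : 0 < G t < 1 by rewrite G0 (lt_le_trans Gs)// cdf1_le1.
have Gq := cdf1_quantile atomless G01; set q := quantile alpha (G t) in Gq.
have qs : q <= s.
  by rewrite leNgt; apply/negP => /ltW /ndF; lra.
rewrite -{2}Gq; apply: le_trans (pr_itvW qs); apply: pr_le => //.
  by apply: measurableI; [exact: mlt|exact: mle].
move=> w /= [Ws GW]; split=> //; rewrite ltNge; apply/negP.
by move=> /ndF; lra.
Qed.

(** Mirror argument, with the bound (G s - F t)^+ in the middle. The event now gives the non-strict
    [F (W w) <= G s], which allows [W] to run along a flat stretch of [F] beyond the [G s]-quantile,
    so a slightly higher level is used. *)
Lemma transport1_coupling_le s t :
  (P [set w | Z w <= s /\ t < W w]%R <= P [set w | Y w <= s /\ t < W w]%R)%E.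
Proof.
have mZW : measurable [set w | Z w <= s /\ t < W w].
  by apply: measurableI; [exact: mle|exact: mlt].
have mYW : measurable [set w | Y w <= s /\ t < W w].
  by apply: measurableI; [exact: mle|exact: mlt].
have mA : measurable [set w | F (W w) <= G s /\ t < W w].
  by apply: measurableI; [exact: mle|exact: mlt].
rewrite -!prE// lee_fin.
have leA : pr [set w | Z w <= s /\ t < W w] <=
    pr [set w | F (W w) <= G s /\ t < W w].
  rewrite -[leRHS]addr0; apply: le_trans (lerD (lexx _) prN).
  apply: le_trans (prU _ _) => //; apply: pr_le => //; first exact: measurableU.
  move=> w /= [Zs tW]; have [F0|F0] := leP (F (W w)) 0; first by right; left.
  have [F1|F1] := leP 1 (F (W w)); first by right; right.
  by left; split=> //; rewrite -quantile_le ?F0.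
have sY : G s - F t <= pr [set w | Y w <= s /\ t < W w].
  rewrite lerBlDr -prW -prY; apply: le_trans (prU _ _) => //; last exact: mle.
  apply: pr_le; [exact: mle|by apply: measurableU => //; exact: mle|].
  by move=> w /= Ys; have [|] := leP (W w) t; [right|left].
apply: le_trans leA _; have [G1|G1] := leP 1 (G s).
  apply: le_trans (_ : 1 - F t <= _); last by lra.
  apply: le_trans (pr_tailW _); apply: pr_le => //; first exact: mlt.
  by move=> w [].
rewrite leNgt; apply/negP; set p := pr [set w | F _ <= _ /\ _] => Yp.
have Y0 := pr_ge0 [set w | Y w <= s /\ t < W w].
(* A level above [G s] but below both 1 and [p + F t]; the latter exceeds [G s] by [sY] and [Yp].
   Strictness forces [W w <= q] on the event, whence [p <= v - F t < p]. *)
pose v := Num.min ((G s + 1) / 2) ((G s + (p + F t)) / 2).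
have G0 := cdf1_ge0 beta s.
have Gv : G s < v by rewrite /v lt_min; lra.
have v01 : 0 < v < 1 by rewrite (le_lt_trans G0 Gv) /v gt_min; lra.
have vp : v - F t < p by rewrite ltrBlDr gt_min; lra.
have vq := cdf1_quantile atomless v01; set q := quantile alpha v in vq.
have sub : [set w | F (W w) <= G s /\ t < W w] `<=`
    [set w | t < W w /\ W w <= q].
  move=> w /= [FG tW]; split=> //; rewrite leNgt; apply/negP.
  by move=> /ltW /ndF; lra.
have [qt|tq] := ltP q t.
  suff : p <= 0 by lra.
  rewrite /p (_ : [set w | _] = set0) ?{1}/pr ?measure0//.
  by apply/seteqP; split=> w // /sub /= [tW Wq]; lra.
have : p <= F q - F t.
  apply: le_trans (pr_itvW tq); apply: pr_le => //.
  by apply: measurableI; [exact: mlt|exact: mle].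
lra.
Qed.

End monotone_coupling.

(** * Hyperplanes are null, so slices have no atoms *)

Section hyperplane_null.
Context {R : realType}.

Lemma lebesgue_eucl0 n : @lebesgue_eucl R n set0 = 0%E.
Proof.
elim: n => [|n IH] /=; first exact: measure0.
by apply: integral0_eq => x _ /=; rewrite xsection0 IH.
Qed.

Lemma dot_col_mx n (a : R) (v : 'cV[R]_n) (theta : 'cV[R]_n.+1) :
  dot (col_mx a%:M v : 'cV[R]_(1 + n)) theta =
  a * theta 0 0 + dot v (dsubmx (theta : 'cV[R]_(1 + n))).
Proof.
rewrite /dot big_ord_recl; congr (_ * _ + _).
  by rewrite (_ : ord0 = lshift n (0 : 'I_1)) ?col_mxEu ?mxE//; exact: val_inj.
apply: eq_bigr => i _.
rewrite (_ : lift ord0 i = rshift 1 i); last exact: val_inj.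
by rewrite col_mxEd mxE.
Qed.

(** Induction on the dimension, slicing along the first coordinate. If the tail [th] of [theta] is
    nonzero, every section lies in a hyperplane of lower dimension; if it vanishes, only the section
    at [c / theta 0 0] can be nonempty, and a single point is null. *)
Lemma lebesgue_eucl_hyperplane n (theta : 'cV[R]_n) (c : R)
    (A : set (eucl R n)) :
  theta != 0 -> A `<=` [set x | dot x theta = c] -> lebesgue_eucl A = 0%E.
Proof.
elim: n theta c A => [|n IH] theta c A theta0 Ac.
  by move: theta0; rewrite [theta]flatmx0 eqxx.
rewrite /= /pushforward /product_measure1.
set B := _ @^-1` A; pose th := dsubmx (theta : 'cV[R]_(1 + n)).
have Bc x v : xsection B x v -> dot v th = c - x * theta 0 0.
  rewrite /xsection/= inE/= => /Ac/=; rewrite dot_col_mx => <-.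
  by rewrite addrAC subrr add0r.
have [th0|] := eqVneq th 0; last first.
  move=> th0; apply: integral0_eq => x _ /=.
  by apply: (IH th (c - x * theta 0 0)) => // v; exact: Bc.
have t0 : theta 0 0 != 0.
  apply: contra_neq theta0 => t0.
  rewrite -[theta](@vsubmxK _ 1 n) -/th th0.
  apply/matrixP => i j; rewrite !mxE; case: splitP => k _; rewrite !mxE//.
  rewrite !ord1 -[RHS]t0; congr (theta _ _); exact: val_inj.
have Bx x : x != c / theta 0 0 -> xsection B x = set0.
  move=> xc; apply/seteqP; split=> v // /Bc; rewrite th0 => e.
  case/eqP: xc; apply: (mulIf t0); rewrite divfK//.
  apply/esym/eqP; rewrite -subr_eq0 -e /dot big1// => i _.
  by rewrite mxE mulr0.
pose x0 := c / theta 0 0.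
transitivity (\int[lebesgue_measure]_(x in [set x0])
    lebesgue_eucl (xsection B x))%E; last first.
  by rewrite (@integral_Sset1 _ _ _ x0).
rewrite [RHS]integral_mkcond; apply: eq_integral => x _ /=; rewrite patchE.
case: ifPn => // ; rewrite notin_setE/= => /eqP xx0.
by rewrite Bx// lebesgue_eucl0.
Qed.

End hyperplane_null.

(** An atom of a slice would be a hyperplane charged by [sigma]. *)
Lemma slice_atomless (R : realType) n (sigma : probability (eucl R n) R)
    (theta : 'cV[R]_n) (c : R) :
  sigma `<< @lebesgue_eucl R n -> theta != 0 -> slice sigma theta [set c] = 0%E.
Proof.
move=> ac theta0.
apply: (ac [set x | dot x theta = c]) => [A mA Ac||//].
  exact: lebesgue_eucl_hyperplane theta0 Ac.
by rewrite -[X in measurable X]setTI; exact: measurable_proj.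
Qed.

(** * Measurability into Euclidean space through coordinates *)

Section measurability_in_eucl.
Context {R : realType} (n : nat).

Lemma measurable_coord (i : 'I_n) :
  measurable_fun setT (fun x : eucl R n => (x : 'cV[R]_n) i 0).
Proof.
apply: eq_measurable_fun (measurable_proj (delta_mx i 0)) => x _.
rewrite /Defs.proj /dot (bigD1 i)//= mxE !eqxx mulr1.
by rewrite big1 ?addr0// => j /negbTE ji; rewrite mxE ji mulr0.
Qed.

Lemma rat_mx_dense (x : 'cV[R]_n) (e : R) : 0 < e ->
  exists q : 'cV[rat]_n, forall i, `|x i 0 - ratr (q i 0)| < e.
Proof.
move=> e0.
have /choice[q qP] : forall i, exists q : rat, `|x i 0 - ratr q| < e.
  move=> i; have [q] := @rat_in_itvoo R (x i 0 - e) (x i 0 + e) ltac:(lra).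
  by rewrite in_itv/= => /andP[q1 q2]; exists q; rewrite ltr_norml; lra.
by exists (\col_i q i) => i; rewrite mxE.
Qed.

(* Sup-norm balls with rational centers and radii [k.+1%:R^-1] generate the
   Borel sets, and they are finite intersections of coordinate slabs. *)
Lemma measurable_fun_eucl d (T : measurableType d) (f : T -> eucl R n) :
  (forall i, measurable_fun setT (fun x => (f x : 'cV[R]_n) i 0)) ->
  measurable_fun setT f.
Proof.
move=> mf.
apply: (@measurability _ _ T (eucl R n) setT f (@open 'cV[R]_n)) => // _ [U oU <-].
rewrite setTI.
pose box (p : 'cV[rat]_n * nat) : set 'cV[R]_n :=
  [set y | forall i, `|y i 0 - ratr (p.1 i 0)| < p.2.+1%:R^-1].
have UE : U = \bigcup_(p in [set p | box p `<=` U]) box p.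
  apply/seteqP; split=> [x Ux|x [p pU /pU//]].
  have /nbhs_ballP[e /= e0 eU] : nbhs x U by exact: open_nbhs_nbhs.
  (* With a radius below [e / 2], a box around a rational [q] close to [x] contains [x] and stays
     within [e] of it. *)
  have [k _ /(_ k (leqnn k))/= ke] :=
    near_infty_natSinv_lt (PosNum (divr_gt0 e0 (ltr0Sn R 1))).
  have [q qx] := @rat_mx_dense x k.+1%:R^-1 ltac:(by rewrite invr_gt0).
  exists (q, k) => //= y /= yq; apply: eU; split => // i j; rewrite (ord1 j).
  rewrite -ball_normE /=; have := yq i; have := qx i.
  rewrite !ltr_norml => /andP[h1 h2] /andP[h3 h4]; move: ke.
  rewrite /=; set r := _^-1 in h1 h2 h3 h4 *; lra.
(* Boxes not inside [U] are replaced by the empty set, so that the union runs over a whole countable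
   type. *)
have -> : f @^-1` U =
    \bigcup_(p in [set: 'cV[rat]_n * nat])
      (f @^-1` (if `[< box p `<=` U >] then box p else set0)).
  rewrite -preimage_bigcup; congr (_ @^-1` _); rewrite [LHS]UE.
  rewrite bigcup_mkcond; apply: eq_bigcupr => p _.
  by rewrite (_ : (p \in _) = `[< box p `<=` U >])//;
    apply/idP/asboolP; rewrite inE.
apply: countable_bigcupT_measurable => [|p]; first exact: countableP.
case: ifP => _; last by rewrite preimage_set0.
rewrite (_ : f @^-1` box p = \bigcap_(i in [set: 'I_n])
    [set x | `|(f x : 'cV[R]_n) i 0 - ratr (p.1 i 0)| < p.2.+1%:R^-1]);
  last first.
  by apply/seteqP; split=> [x h i _|x h i]; [exact: h|exact: (h i I)].
apply: fin_bigcap_measurable => [|i _]; first exact: finite_finset.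
apply: measurable_pred; apply: measurable_fun_ltr => //.
by apply: measurableT_comp => //; exact: measurable_funB.
Qed.

End measurability_in_eucl.

(** * Orthonormal coordinates and the slice map *)

Section euclidean.
Context {R : realType} (n : nat).
Implicit Types (x y : 'cV[R]_n) (P : 'M[R]_n).

Lemma dotDl x y z : dot (x + y) z = dot x z + dot y z.
Proof.
by rewrite /dot -big_split/=; apply: eq_bigr => i _; rewrite mxE mulrDl.
Qed.

Lemma dotZl a x y : dot (a *: x) y = a * dot x y.
Proof. by rewrite /dot mulr_sumr; apply: eq_bigr => i _; rewrite mxE mulrA. Qed.

Lemma dotBl x y z : dot (x - y) z = dot x z - dot y z.
Proof. by rewrite -scaleN1r dotDl dotZl mulN1r. Qed.

Lemma enorm_sqr x : enorm x ^+ 2 = dot x x.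
Proof. by rewrite sqr_sqrtr// sumr_ge0// => i _; rewrite -expr2 sqr_ge0. Qed.

Lemma dot_col P x i : dot x (col i P) = (P^T *m x) i 0.
Proof. by rewrite mxE; apply: eq_bigr => j _; rewrite !mxE mulrC. Qed.

Lemma dot_mulmx x y : dot x y = (x^T *m y) 0 0.
Proof. by rewrite mxE; apply: eq_bigr => j _; rewrite !mxE. Qed.

(** Parseval: the one-sided inverse [P^T] of a square matrix is two-sided, so [P^T] preserves [dot]
    as well. *)
Lemma enorm_sqr_orthogonal P x : orthogonal_group P ->
  enorm x ^+ 2 = \sum_(i < n) dot x (col i P) ^+ 2.
Proof.
move=> /mulmx1C PP; transitivity (dot (P^T *m x) (P^T *m x)).
  by rewrite enorm_sqr !dot_mulmx trmx_mul trmxK mulmxA -(mulmxA _ P) PP mulmx1.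
by apply: eq_bigr => i _; rewrite dot_col expr2.
Qed.

Lemma dot_col_col P i j : orthogonal_group P ->
  dot (col i P) (col j P) = (i == j)%:R.
Proof.
by move=> PP; rewrite dot_col colE mulmxA PP mul1mx mxE eqxx andbT eq_sym.
Qed.

Lemma col_orthogonal_neq0 P i : orthogonal_group P -> col i P != 0.
Proof.
move=> PP; apply: contra_eq_neq (dot_col_col i i PP) => ->.
by rewrite /dot big1 ?eqxx 1?eq_sym ?oner_eq0// => j _; rewrite mxE mul0r.
Qed.

Lemma dot_slice_map (sigma mu : probability (eucl R n) R) P x i :
  orthogonal_group P ->
  dot (slice_map sigma mu P x) (col i P) =
  transport1 (slice sigma (col i P)) (slice mu (col i P)) (dot x (col i P)).
Proof.
move=> PP; rewrite /slice_map.
transitivity (\sum_(j < n)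
    transport1 (slice sigma (col j P)) (slice mu (col j P)) (dot x (col j P)) *
    dot (col j P) (col i P)).
  elim/big_rec2: _ => [|j u v _ <-]; last by rewrite dotDl dotZl.
  by rewrite /dot big1// => j _; rewrite mxE mul0r.
rewrite (bigD1 i)//= dot_col_col// eqxx mulr1 big1 ?addr0// => j ji.
by rewrite dot_col_col// (negbTE ji) mulr0.
Qed.

Lemma measurable_slice_map (sigma mu : probability (eucl R n) R) P :
  measurable_fun setT (slice_map sigma mu P).
Proof.
apply: measurable_fun_eucl => i.
apply: (@eq_measurable_fun _ _ (eucl R n) R _ (fun x : eucl R n => \sum_(j < n)
    transport1 (slice sigma (col j P)) (slice mu (col j P))
      (Defs.proj (col j P) x) * P i j)).
  by move=> x _; rewrite /slice_map summxE; apply: eq_bigr => j _; rewrite !mxE.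
apply: measurable_sum => j; apply: measurable_funM => //.
exact: measurableT_comp (measurable_transport1 _ _) (measurable_proj _).
Qed.

Lemma measurable_affine a (b : eucl R n) :
  measurable_fun setT (fun x : eucl R n => a *: (x - b) : eucl R n).
Proof.
apply: measurable_fun_eucl => i.
apply: (@eq_measurable_fun _ _ (eucl R n) R _
  (fun x : eucl R n => a * ((x : 'cV[R]_n) i 0 - b i 0))).
  by move=> x _; rewrite !mxE.
apply: measurable_funM => //; apply: measurable_funB => //.
exact: measurable_coord.
Qed.

Lemma enorm_sqr_coord x : enorm x ^+ 2 = \sum_(i < n) x i 0 ^+ 2.
Proof. by rewrite enorm_sqr; apply: eq_bigr => i _; rewrite expr2. Qed.

Lemma enorm_sqr_le x y z :
  enorm (y - z) ^+ 2 <= 2 * enorm (x - y) ^+ 2 + 2 * enorm (x - z) ^+ 2.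
Proof.
rewrite !enorm_sqr_coord !mulr_sumr -big_split/=; apply: ler_sum => i _.
rewrite !mxE -subr_ge0; set u := x i 0; set v := y i 0; set w := z i 0.
have -> : 2 * (u - v) ^+ 2 + 2 * (u - w) ^+ 2 - (v - w) ^+ 2 =
  (2 * u - v - w) ^+ 2 by ring.
exact: sqr_ge0.
Qed.

Lemma measurable_enorm_sqr_diff d (T : measurableType d) (f g : T -> eucl R n) :
  measurable_fun setT f -> measurable_fun setT g ->
  measurable_fun setT (fun z => (enorm (f z - g z) ^+ 2)%:E).
Proof.
move=> mf mg; apply: (@eq_measurable_fun _ _ _ _ _ (fun z =>
    (\sum_(i < n) ((f z : 'cV[R]_n) i 0 - (g z : 'cV[R]_n) i 0) ^+ 2)%:E)).
  move=> z _; rewrite enorm_sqr_coord; congr EFin.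
  by apply: eq_bigr => i _; rewrite !mxE.
apply/measurable_EFinP/measurable_sum => i; apply: measurable_funX.
by apply: measurable_funB; exact: measurableT_comp (measurable_coord i) _.
Qed.

End euclidean.

(** Source of the constant: 2 + 2 = 4 on squared costs becomes 2 after the square root. *)
Lemma le_integral_double_sum (R : realType) d (T : measurableType d)
    (p : probability T R) (h f g : T -> R) :
  measurable_fun setT (EFin \o h) -> measurable_fun setT (EFin \o f) ->
  measurable_fun setT (EFin \o g) ->
  (forall z, 0 <= h z) -> (forall z, 0 <= f z) -> (forall z, 0 <= g z) ->
  (forall z, h z <= 2 * f z + 2 * g z) ->
  (\int[p]_z (f z)%:E <= \int[p]_z (g z)%:E)%E ->
  (\int[p]_z (h z)%:E <= 4%:E * \int[p]_z (g z)%:E)%E.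
Proof.
move=> mh mf mg h0 f0 g0 hfg fg.
apply: (@le_trans _ _ (\int[p]_z (2%:E * (f z)%:E + 2%:E * (g z)%:E))%E).
  apply: ge0_le_integral => //.
  - by move=> z _; rewrite lee_fin.
  - by apply: emeasurable_funD; exact: measurable_funeM.
  - by move=> z _; rewrite -!EFinM -EFinD lee_fin.
rewrite ge0_integralD//=; last 4 first.
- by move=> z _; rewrite -EFinM lee_fin mulr_ge0.
- exact: measurable_funeM.
- by move=> z _; rewrite -EFinM lee_fin mulr_ge0.
- exact: measurable_funeM.
rewrite !ge0_integralZl//; try by move=> z _; rewrite lee_fin.
have -> : (4%:E = 2%:E + 2%:E :> \bar R)%E by rewrite -EFinD; congr EFin; lra.
by rewrite ge0_muleDl//; apply: leeD => //; exact: lee_wpmul2l.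
Qed.

(** * Transforming a coupling of [S_# sigma] into one of [T_# sigma] *)

Section slice_coupling.
Context {R : realType} (n : nat).
Variables (sigma mu : probability (eucl R n) R) (P : 'M[R]_n).
Hypotheses (ac : sigma `<< @lebesgue_eucl R n) (PP : orthogonal_group P).
Variables (a : R) (b : eucl R n) (S : eucl R n -> eucl R n).
Hypotheses (a0 : 0 < a) (SE : forall x, S x = a *: x + b).
Variable pi : probability (eucl R n * eucl R n)%type R.
Hypothesis pi_coupling : coupling (pushforward sigma S) mu pi.

(** [S^-1] of the first component, which has law [sigma] under [pi]. *)
Let V (z : eucl R n * eucl R n) : eucl R n := a^-1 *: (z.1 - b).
Let T := slice_map sigma mu P.

Let mV : measurable_fun setT V.
Proof. exact: measurableT_comp (measurable_affine a^-1 b) measurable_fst. Qed.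

Let lawV A : measurable A -> pi (V @^-1` A) = sigma A.
Proof.
move=> mA; have mVA :
    measurable ((fun x : eucl R n => a^-1 *: (x - b) : eucl R n) @^-1` A).
  by rewrite -[X in measurable X]setTI; exact: measurable_affine.
apply: (etrans (pi_coupling mVA).1).
rewrite /pushforward; congr (sigma _); apply/funext => x /=.
by rewrite SE addrK scalerA mulVf ?scale1r// gt_eqF.
Qed.

Let mproj_snd i :
  measurable_fun setT (fun z : eucl R n * eucl R n => dot z.2 (col i P)).
Proof. exact: measurableT_comp (measurable_proj _) measurable_snd. Qed.

Let mproj_fst i :
  measurable_fun setT (fun z : eucl R n * eucl R n => dot z.1 (col i P)).
Proof. exact: measurableT_comp (measurable_proj _) measurable_fst. Qed.

Let mproj_V i : measurable_fun setT (fun z => dot (V z) (col i P)).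
Proof. exact: measurableT_comp (measurable_proj _) mV. Qed.

Let mproj_TV i : measurable_fun setT (fun z => dot (T (V z)) (col i P)).
Proof.
apply: measurableT_comp (measurable_proj _) _.
exact: measurableT_comp (measurable_slice_map _ _ _) mV.
Qed.

(** As [a > 0], an inequality on the slice of [z.1] is one on the slice of [V z] with a rescaled
    threshold. The one-dimensional bounds then apply with [W] the slice of [V z] and [Y] that of
    [z.2]. *)
Let slice_cost i :
  (\int[pi]_z ((dot z.1 (col i P) - dot (T (V z)) (col i P)) ^+ 2)%:E <=
   \int[pi]_z ((dot z.1 (col i P) - dot z.2 (col i P)) ^+ 2)%:E)%E.
Proof.
have fst_le s z : (dot z.1 (col i P) <= s) =
    (dot (V z) (col i P) <= a^-1 * (s - dot b (col i P))).
  by rewrite dotZl dotBl ler_pM2l ?invr_gt0// lerD2r.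
have lawVi A : measurable A ->
    pi ((fun z => dot (V z) (col i P)) @^-1` A) = slice sigma (col i P) A.
  move=> mA; rewrite -[RHS]lawV//.
  by rewrite -[X in measurable X]setTI; exact: measurable_proj.
have lawYi A : measurable A ->
    pi ((fun z => dot z.2 (col i P)) @^-1` A) = slice mu (col i P) A.
  move=> mA; suff mpA : measurable (Defs.proj (col i P) @^-1` A).
    exact: (pi_coupling mpA).2.
  by rewrite -[X in measurable X]setTI; exact: measurable_proj.
have atomless c := slice_atomless c ac (col_orthogonal_neq0 i PP).
apply: le_integral_sqr_diff => // s t _.
- have := transport1_coupling_ge (mproj_V i) (mproj_snd i) lawVi lawYi atomless
    (a^-1 * (s - dot b (col i P))) t.
  by under eq_set do rewrite -dot_slice_map// -fst_le;
    under [in leRHS]eq_set do rewrite -fst_le.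
- have := transport1_coupling_le (mproj_V i) (mproj_snd i) lawVi lawYi atomless
    s (a^-1 * (t - dot b (col i P))).
  have fst_gt z : (a^-1 * (t - dot b (col i P)) < dot (V z) (col i P)) =
      (t < dot z.1 (col i P)) by rewrite !ltNge fst_le.
  by under eq_set do rewrite -dot_slice_map// fst_gt;
    under [in leRHS]eq_set do rewrite fst_gt.
Qed.

Let msqr_diff d (U : measurableType d) (f g : U -> R) :
  measurable_fun setT f -> measurable_fun setT g ->
  measurable_fun setT (fun z => ((f z - g z) ^+ 2)%:E).
Proof.
move=> mf mg; apply/measurable_EFinP/measurable_funX; exact: measurable_funB.
Qed.

Let integral_enorm (f g : eucl R n * eucl R n -> eucl R n) :
  (forall i, measurable_fun setT (fun z => dot (f z) (col i P))) ->
  (forall i, measurable_fun setT (fun z => dot (g z) (col i P))) ->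
  (\int[pi]_z (enorm (f z - g z) ^+ 2)%:E =
   \sum_(i < n)
     \int[pi]_z ((dot (f z) (col i P) - dot (g z) (col i P)) ^+ 2)%:E)%E.
Proof.
move=> mf mg; rewrite -ge0_integral_sum//.
- apply: eq_integral => z _; rewrite sumEFin (enorm_sqr_orthogonal _ PP).
  by congr EFin; apply: eq_bigr => i _; rewrite dotBl.
- by move=> i; exact: msqr_diff.
- by move=> i z _; rewrite lee_fin sqr_ge0.
Qed.

Let cost_TV : (\int[pi]_z (enorm (z.1 - T (V z)) ^+ 2)%:E <=
               \int[pi]_z (enorm (z.1 - z.2) ^+ 2)%:E)%E.
Proof.
by rewrite !integral_enorm//; apply: lee_sum => i _; exact: slice_cost.
Qed.

Lemma slice_map_coupling :
  exists2 pi' : probability (eucl R n * eucl R n)%type R,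
  coupling (pushforward sigma T) mu pi' &
  (\int[pi']_z (enorm (z.1 - z.2) ^+ 2)%:E <=
   4%:E * \int[pi]_z (enorm (z.1 - z.2) ^+ 2)%:E)%E.
Proof.
pose g z := (T (V z), z.2).
have mTV : measurable_fun setT (T \o V).
  exact: measurableT_comp (measurable_slice_map _ _ _) mV.
have mg : measurable_fun setT g.
  exact: measurable_fun_pair mTV measurable_snd.
pose G : {mfun _ >-> _} := HB.pack g (isMeasurableFun.Build _ _ _ _ _ mg).
exists (distribution pi G) => [A mA|].
  split; last exact: (pi_coupling mA).2.
  rewrite -[RHS]lawV// -[X in measurable X]setTI.
  exact: measurable_slice_map.
rewrite ge0_integral_distribution; last 2 first.
- exact: measurable_enorm_sqr_diff measurable_fst measurable_snd.
- by move=> z; rewrite lee_fin sqr_ge0.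
(* The intermediate point between [T (V z)] and [z.2] is [z.1]. *)
apply: (le_integral_double_sum _ _ _ _ _ _ _ cost_TV).
- exact: (measurable_enorm_sqr_diff mTV measurable_snd).
- exact: (measurable_enorm_sqr_diff measurable_fst mTV).
- exact: (measurable_enorm_sqr_diff measurable_fst measurable_snd).
- by move=> z; exact: sqr_ge0.
- by move=> z; exact: sqr_ge0.
- by move=> z; exact: sqr_ge0.
- by move=> z; exact: enorm_sqr_le.
Qed.

End slice_coupling.

(** * From couplings to Wasserstein distances *)

Theorem proposition4p10 (R : realType) (n : nat)
    (sigma mu : probability (eucl R n) R) (P : 'M[R]_n) :
  wass2_ac_space sigma -> wass2_space mu -> orthogonal_group P ->
  (W2 (pushforward sigma (slice_map sigma mu P)) mu
   <= 2%:E * ereal_inf [set W2 (pushforward sigma S) mu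
                       | S in @scaling_translation R n])%E.
Proof.
(* Once the factor 2 is on the left, both infima on the right can be treated one [S] and one [pi] at
   a time. *)
move=> [_ ac] _ PP; rewrite -lee_pdivrMl//.
apply: le_ereal_inf_tmp => _ [S [a [b [a0 SE]]] <-].
apply: le_ereal_inf_tmp => _ [pi pi_coupling <-].
have [pi' pi'_coupling cost] := slice_map_coupling ac PP a0 SE pi_coupling.
rewrite lee_pdivrMl//; apply: ge_ereal_inf; eexists; first by exists pi'.
have I0 (p : probability (eucl R n * eucl R n)%type R) :
    (0 <= \int[p]_z (enorm (z.1 - z.2) ^+ 2)%:E)%E.
  by apply: integral_ge0 => z _; rewrite lee_fin sqr_ge0.
(* The square root is monotone on [0, +oo], and the factor 4 leaves it as 2. *)
apply: le_trans (gt0_ler_poweR _ _ _ cost) _ => //.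
- by rewrite in_itv/= I0 leey.
- by rewrite in_itv/= mule_ge0// leey.
rewrite poweRM// poweR_EFin (_ : 4 = 2 ^+ 2); last by ring.
by rewrite -powR_mulrn// -powRrM mulfV// powRr1.
Qed.
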